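(* Consider a node $J$ with one incoming arc (index $1$) and one outgoing arc (index $2$), with flux $f$. There exists a unique Riemann solver $\mathcal{RS}$ at $J$ satisfying the entropy inequality $\mathrm{sgn}(\bar\rho_1-k)(f(\bar\rho_1)-f(k))-\mathrm{sgn}(\bar\rho_2-k)(f(\bar\rho_2)-f(k))\ge0$ for every initial datum $(\rho_{1,0},\rho_{2,0})\in[0,1]^2$ and every $k\in[0,1]$, where $(\bar\rho_1,\bar\rho_2)=\mathcal{RS}(\rho_{1,0},\rho_{2,0})$. This Riemann solver satisfies the consistency condition, and it coincides with the Riemann solver $\mathcal{RS}_1$ for car traffic and with the Riemann solver $\mathcal{RS}_2$ for data networks.
   Context: Flux: $f:[0,1]\to\mathbb R$ is a continuous, piecewise smooth, concave function with $f(0)=f(1)=0$, and there is a unique $\sigma\in\,]0,1[$ such that $f$ is strictly increasing on $[0,\sigma[$ and strictly decreasing on $]\sigma,1]$. Let $\tau:[0,1]\to[0,1]$ be the map with $f(\tau(\rho))=f(\rho)$ for all $\rho\in[0,1]$ and $\tau(\rho)\neq\rho$ for all $\rho\ne\sigma$. Convention: $\mathrm{sgn}(0)=0$. Riemann solver (one incoming, one outgoing arc): a function $\mathcal{RS}:[0,1]^2\to[0,1]^2$, $(\rho_{1,0},\rho_{2,0})\mapsto(\bar\rho_1,\bar\rho_2)$, such that for every initial datum: (1) $f(\bar\rho_1)=f(\bar\rho_2)$; (2) the classical Riemann problem for $\rho_t+f(\rho)_x=0$ with left state $\rho_{1,0}$ and right state $\bar\rho_1$ is solved with waves with negative speed;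 that is, $\bar\rho_1\in\{\rho_{1,0}\}\cup\,]\tau(\rho_{1,0}),1]$ if $\rho_{1,0}\le\sigma$ and $\bar\rho_1\in[\sigma,1]$ if $\rho_{1,0}\ge\sigma$; (3) the classical Riemann problem with left state $\bar\rho_2$ and right state $\rho_{2,0}$ is solved with waves with positive speed; that is, $\bar\rho_2\in[0,\sigma]$ if $\rho_{2,0}\le\sigma$ and $\bar\rho_2\in\{\rho_{2,0}\}\cup[0,\tau(\rho_{2,0})[$ if $\rho_{2,0}\ge\sigma$. (E1): $\mathcal{RS}$ satisfies (E1) if for every initial datum and every $k\in[0,1]$, with $(\bar\rho_1,\bar\rho_2)=\mathcal{RS}(\rho_{1,0},\rho_{2,0})$, one has $\mathrm{sgn}(\bar\rho_1-k)(f(\bar\rho_1)-f(k))-\mathrm{sgn}(\bar\rho_2-k)(f(\bar\rho_2)-f(k))\ge0$. Consistency condition: $\mathcal{RS}(\mathcal{RS}(\rho_{1,0},\rho_{2,0}))=\mathcal{RS}(\rho_{1,0},\rho_{2,0})$ for every $(\rho_{1,0},\rho_{2,0})\in[0,1]^2$. The solvers $\mathcal{RS}_1$, $\mathcal{RS}_2$ for one incoming and one outgoing arc: given the initial datum, let $\Omega_1=[0,f(\rho_{1,0})]$ if $\rho_{1,0}\le\sigma$ and $\Omega_1=[0,f(\sigma)]$ if $\rho_{1,0}\ge\sigma$; let $\Omega_2=[0,f(\sigma)]$ if $\rho_{2,0}\le\sigma$ and $\Omega_2=[0,f(\rho_{2,0})]$ if $\rho_{2,0}\ge\sigma$. For $\mathcal{RS}_1$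 (with the $1\times1$ distribution matrix $A=(1)$): $\bar\gamma_1$ is the maximizer of $\gamma_1$ over $\{\gamma_1\in\Omega_1:\gamma_1\in\Omega_2\}$ and $\bar\gamma_2=\bar\gamma_1$. For $\mathcal{RS}_2$ (with $\boldsymbol\theta=(1,1)$): $\Gamma=\min\{\sup\Omega_1,\sup\Omega_2\}$, and $\bar\gamma_1$, $\bar\gamma_2$ are the projections of $\Gamma$ onto $\{\gamma\in\Omega_1:\gamma=\Gamma\}$ and $\{\gamma\in\Omega_2:\gamma=\Gamma\}$ respectively. In both cases, $\bar\rho_1=\rho_{1,0}$ if $f(\rho_{1,0})=\bar\gamma_1$, and otherwise $\bar\rho_1$ is the solution of $f(\rho)=\bar\gamma_1$ with $\rho\ge\sigma$; $\bar\rho_2=\rho_{2,0}$ if $f(\rho_{2,0})=\bar\gamma_2$, and otherwise $\bar\rho_2$ is the solution of $f(\rho)=\bar\gamma_2$ with $\rho\le\sigma$; the solver returns $(\bar\rho_1,\bar\rho_2)$. *)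

(* Defs.v *)
From HB Require Import structures.
From mathcomp Require Import all_boot all_order all_algebra.
From mathcomp Require Import all_classical all_reals all_analysis.

Set Implicit Arguments.
Unset Strict Implicit.
Unset Printing Implicit Defensive.

Import Order.TTheory GRing.Theory Num.Theory.
Import numFieldNormedType.Exports.

Local Open Scope classical_set_scope.
Local Open Scope ring_scope.

(* Densities are elements of the type [{i01 R}] of reals in [0, 1]. The flux is
   a total function [R -> R], and none of the predicates below depends on its
   values outside [0, 1]. *)

(* The pieces are the open intervals between consecutive break points, so that
   one-sided derivatives at the break points and at 0 and 1 may be infinite. *)
Definition piecewise_smooth (R : realType) (f : R -> R) : Prop :=
  exists2 S : set R, finite_set S &
    forall x : R, x \in `]0, 1[ -> ~ S x ->
      forall n, derivable (derive1n n f) x 1.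

Definition unimodal (R : realType) (f : R -> R) (s : R) : Prop :=
  [/\ s \in `]0, 1[,
      {in `[0, s[ &, {homo f : x y / x < y}} &
      {in `]s, 1] &, {homo f : x y /~ x < y}}].

Record is_flux (R : realType) (f : R -> R) (sigma : R) : Prop := IsFlux {
  flux_continuous : {within `[0, 1], continuous f};
  flux_piecewise_smooth : piecewise_smooth f;
  flux_concave : convex_function (`[0, 1] : set R^o) (fun x => - f x);
  flux0 : f 0 = 0;
  flux1 : f 1 = 0;
  flux_unimodal : unique (unimodal f) sigma
}.

Definition is_tau (R : realType) (f : R -> R) (sigma : R)
    (tau : {i01 R} -> {i01 R}) : Prop :=
  (forall r, f (tau r)%:num = f r%:num) /\
  (forall r, r%:num <> sigma -> tau r <> r).

Section Node.
Variables (R : realType) (f : R -> R) (sigma : R).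

(* Component 1 refers to the incoming arc, component 2 to the outgoing one. *)
Local Notation data := ({i01 R} * {i01 R})%type.

Definition negative_waves (tau : {i01 R} -> {i01 R}) (r0 r : {i01 R}) : Prop :=
  (r0%:num <= sigma -> ([set r0%:num] `|` `](tau r0)%:num, 1]) r%:num) /\
  (sigma <= r0%:num -> `[sigma, 1]%classic r%:num).

Definition positive_waves (tau : {i01 R} -> {i01 R}) (r0 r : {i01 R}) : Prop :=
  (r0%:num <= sigma -> `[0, sigma]%classic r%:num) /\
  (sigma <= r0%:num -> ([set r0%:num] `|` `[0, (tau r0)%:num[) r%:num).

Definition riemann_solver (tau : {i01 R} -> {i01 R}) (RS : data -> data) :
    Prop :=
  forall d, [/\ f (RS d).1%:num = f (RS d).2%:num,
                negative_waves tau d.1 (RS d).1 &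
                positive_waves tau d.2 (RS d).2].

Definition E1 (RS : data -> data) : Prop :=
  forall (d : data) (k : {i01 R}),
    0 <= Num.sg ((RS d).1%:num - k%:num) * (f (RS d).1%:num - f k%:num)
       - Num.sg ((RS d).2%:num - k%:num) * (f (RS d).2%:num - f k%:num).

Definition consistent (RS : data -> data) : Prop :=
  forall d, RS (RS d) = RS d.

Definition Omega1 (r0 : {i01 R}) : set R :=
  if r0%:num <= sigma then `[0, f r0%:num]%classic else `[0, f sigma]%classic.

Definition Omega2 (r0 : {i01 R}) : set R :=
  if r0%:num <= sigma then `[0, f sigma]%classic else `[0, f r0%:num]%classic.

Definition is_maximizer (A : set R) (g : R) : Prop := A g /\ ubound A g.

Definition is_projection (A : set R) (x p : R) : Prop :=
  A p /\ forall q, A q -> `|x - p| <= `|x - q|.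

Definition incoming_state (r0 : {i01 R}) (g : R) (r : {i01 R}) : Prop :=
  if f r0%:num == g then r = r0 else f r%:num = g /\ sigma <= r%:num.

Definition outgoing_state (r0 : {i01 R}) (g : R) (r : {i01 R}) : Prop :=
  if f r0%:num == g then r = r0 else f r%:num = g /\ r%:num <= sigma.

(* The solvers RS1 and RS2 are given by their graphs: [RS1 d r] says that r is
   returned for the datum d. That they are well-defined functions is part of
   what [coincides] asserts. *)
Definition RS1 (d r : data) : Prop :=
  exists g1 g2 : R,
    [/\ is_maximizer [set g | Omega1 d.1 g /\ Omega2 d.2 g] g1,
        g2 = g1,
        incoming_state d.1 g1 r.1 &
        outgoing_state d.2 g2 r.2].

Definition RS2 (d r : data) : Prop :=
  let Gamma := Num.min (sup (Omega1 d.1)) (sup (Omega2 d.2)) in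
  exists g1 g2 : R,
    [/\ is_projection [set g | Omega1 d.1 g /\ g = Gamma] Gamma g1,
        is_projection [set g | Omega2 d.2 g /\ g = Gamma] Gamma g2,
        incoming_state d.1 g1 r.1 &
        outgoing_state d.2 g2 r.2].

Definition coincides (RS : data -> data) (G : data -> data -> Prop) : Prop :=
  forall d r, G d r <-> r = RS d.

End Node.

(* Main.v *)
Require Import Defs.
From mathcomp Require Import all_boot all_order all_algebra.
From mathcomp Require Import all_classical all_reals all_analysis.

(** The flux fixes which fluxes through the node are attainable: an incoming
    datum can send at most its demand, an outgoing one can absorb at most its
    supply, and once a flux g in these ranges is chosen, the wave conditions
    determine both traces (lemmas [negative_wavesP], [positive_wavesP]). A
    Riemann solver is thus nothing but a choice, for every datum, of a flux g
    with 0 <= g <= min(demand, supply), and the theorem says that entropy forces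
    g = min(demand, supply).

    Two traces a (incoming) and b (outgoing) with equal flux are either equal or
    on opposite sides of sigma. If a < b, the flux is at least f a on [a, b] and
    the entropy inequality holds; if b < a, it fails at k = sigma. Hence (E1)
    means a <= b ([entropyP]). A flux strictly below both demand and supply
    forces a > sigma > b, which entropy excludes; conversely a flux equal to the
    demand or to the supply gives a <= sigma or b >= sigma, whence a <= b
    ([le_traces], [node_traces_le]).

    The solvers for car traffic and for data networks both select the flux
    min(demand, supply): it is the maximum of the intersection of the two
    intervals [0, demand] and [0, supply], and also the common value onto which
    the second solver projects. Consistency holds because traces with a <= b and
    common flux g have min(demand a, supply b) = g. *)

Import Order.TTheory GRing.Theory Num.Theory.
Import numFieldNormedType.Exports.
Local Open Scope ring_scope.

Section Node.
Context {R : realType} {f : R -> R} {sigma : R}.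
Hypothesis hf : is_flux f sigma.

Local Notation data := ({i01 R} * {i01 R})%type.
Implicit Types (r a b : {i01 R}) (d t : data).

(** * Shape of the flux *)

Let sigma01 : 0 < sigma < 1.
Proof. by have [[]] := flux_unimodal hf; rewrite in_itv. Qed.

Let sigma_gt0 : 0 < sigma. Proof. by case/andP: sigma01. Qed.
Let sigma_lt1 : sigma < 1. Proof. by case/andP: sigma01. Qed.

(** Unimodality says nothing about the value at sigma itself: it is the point
    where continuity enters. A maximum point c of f cannot be on the left of
    sigma, since f increases between c and the midpoint of c and sigma, nor, for
    the same reason, on the right. *)
Lemma flux_le_peak x : 0 <= x <= 1 -> f x <= f sigma.
Proof.
have [c] := @EVT_max R f 0 1 ler01 (flux_continuous hf).
rewrite in_itv /= => /andP[c0 c1] cmax.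
have [[_ finc fdec] _] := flux_unimodal hf.
suff -> : sigma = c by move=> x01; apply: cmax; rewrite in_itv.
have [cs|sc|//] := ltgtP c sigma.
- have [cm ms] := midf_lt cs.
  have /finc -/(_ _ _ cm) : c \in `[0, sigma[ by rewrite in_itv /= c0.
  set m := (c + sigma) / 2 in cm ms *.
  have m0 : 0 <= m by apply: le_trans (ltW cm).
  rewrite in_itv /= m0 ms => /(_ isT).
  by rewrite ltNge cmax// in_itv /= m0 ltW// (lt_trans ms).
- have [sm mc] := midf_lt sc.
  set m := (sigma + c) / 2 in sm mc *.
  have m1 : m <= 1 by apply: le_trans (ltW mc) _.
  have := fdec c m; rewrite !in_itv /= sc c1 sm m1 => /(_ isT isT mc).
  by rewrite ltNge cmax// in_itv /= m1 andbT ltW// (lt_trans sigma_gt0).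
Qed.

Lemma flux_increasing x y : 0 <= x -> x < y -> y <= sigma -> f x < f y.
Proof.
have [[_ finc _] _] := flux_unimodal hf.
have open u v : 0 <= u -> u < v -> v < sigma -> f u < f v.
  move=> u0 uv vs; apply: finc => //; rewrite in_itv /=.
    by rewrite u0 (lt_trans uv).
  by rewrite vs (le_trans u0)// ltW.
move=> x0 xy; rewrite le_eqVlt => /predU1P[ys|]; last exact: open.
rewrite {}ys in xy *; have [xm ms] := midf_lt xy.
apply: (lt_le_trans (open _ _ x0 xm ms)); apply: flux_le_peak.
by rewrite (le_trans x0 (ltW xm)) ltW// (lt_trans ms).
Qed.

Lemma flux_decreasing x y : sigma <= x -> x < y -> y <= 1 -> f y < f x.
Proof.
have [[_ _ fdec] _] := flux_unimodal hf.
have open u v : sigma < u -> u < v -> v <= 1 -> f v < f u.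
  move=> su uv v1; apply: fdec => //; rewrite in_itv /=.
    by rewrite v1 (lt_trans su).
  by rewrite su (le_trans (ltW uv)).
move=> + xy y1; rewrite le_eqVlt => /predU1P[sx|sx]; last exact: open.
rewrite -{}sx in xy *; have [sm my] := midf_lt xy.
apply: (lt_le_trans (open _ _ sm my y1)); apply: flux_le_peak.
by rewrite (ltW (lt_trans sigma_gt0 sm)) (le_trans (ltW my)).
Qed.

Lemma flux_ge0 x : 0 <= x <= 1 -> 0 <= f x.
Proof.
case/andP=> x0 x1; have [xs|sx] := leP x sigma.
  move: x0; rewrite le_eqVlt => /predU1P[<-|x0]; first by rewrite (flux0 hf).
  by rewrite -(flux0 hf) ltW// flux_increasing.
move: x1; rewrite le_eqVlt => /predU1P[->|x1]; first by rewrite (flux1 hf).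
by rewrite -(flux1 hf) ltW// flux_decreasing// ltW.
Qed.

Let i01_ge0 r : 0 <= r%:num. Proof. exact: ge0. Qed.
Let i01_le1 r : r%:num <= 1. Proof. exact: le1. Qed.
Let i01_bounds r : 0 <= r%:num <= 1.
Proof. by rewrite i01_ge0 i01_le1. Qed.

Lemma flux_left_inj a b :
  a%:num <= sigma -> b%:num <= sigma -> f a%:num = f b%:num -> a = b.
Proof.
move=> aS bS fab; apply: val_inj => /=.
have [ab|ba|//] := ltgtP a%:num b%:num.
  by have := flux_increasing _ _ (i01_ge0 a) ab bS; rewrite fab ltxx.
by have := flux_increasing _ _ (i01_ge0 b) ba aS; rewrite fab ltxx.
Qed.

Lemma flux_right_inj a b :
  sigma <= a%:num -> sigma <= b%:num -> f a%:num = f b%:num -> a = b.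
Proof.
move=> aS bS fab; apply: val_inj => /=.
have [ab|ba|//] := ltgtP a%:num b%:num.
  by have := flux_decreasing _ _ aS ab (i01_le1 b); rewrite fab ltxx.
by have := flux_decreasing _ _ bS ba (i01_le1 a); rewrite fab ltxx.
Qed.

Lemma flux_right_lt a b :
  sigma <= a%:num -> sigma <= b%:num ->
  (f a%:num < f b%:num) = (b%:num < a%:num).
Proof.
move=> aS bS; have [ba|ab|ab] := ltgtP b%:num a%:num.
- by rewrite flux_decreasing ?i01_le1.
- by apply/negbTE; rewrite -leNgt ltW// flux_decreasing ?i01_le1.
- by rewrite ab ltxx.
Qed.

Lemma flux_left_lt a b :
  a%:num <= sigma -> b%:num <= sigma ->
  (f a%:num < f b%:num) = (a%:num < b%:num).
Proof.
move=> aS bS; have [ab|ba|ab] := ltgtP a%:num b%:num.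
- by rewrite flux_increasing ?i01_ge0.
- by apply/negbTE; rewrite -leNgt ltW// flux_increasing ?i01_ge0.
- by rewrite ab ltxx.
Qed.

Lemma flux_eq_peak r : f r%:num = f sigma -> r%:num = sigma.
Proof.
move=> fr; have [rs|sr|//] := ltgtP r%:num sigma.
  by have := flux_increasing _ _ (i01_ge0 r) rs (lexx _); rewrite fr ltxx.
by have := flux_decreasing _ _ (lexx _) sr (i01_le1 r); rewrite fr ltxx.
Qed.

Let continuous_sub x y : 0 <= x -> y <= 1 ->
  {within `[x, y], continuous f}%classic.
Proof.
move=> x0 y1; have := flux_continuous hf.
apply: continuous_subspaceW => z /=.
by rewrite !in_itv /= => /andP[xz zy]; rewrite (le_trans x0)// (le_trans zy).
Qed.

Lemma flux_left_surj g :
  0 <= g <= f sigma -> exists r, f r%:num = g /\ r%:num <= sigma.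
Proof.
move=> g01; have s0 := ltW sigma_gt0; have s1 := ltW sigma_lt1.
have [|c] := @IVT R f 0 sigma g s0 (continuous_sub _ _ (lexx _) s1).
  by rewrite (flux0 hf) min_l ?max_r// flux_ge0// s0.
rewrite in_itv /= => /andP[c0 cs] <-.
by exists (Itv01 c0 (le_trans cs s1)).
Qed.

Lemma flux_right_surj g :
  0 <= g <= f sigma -> exists r, f r%:num = g /\ sigma <= r%:num.
Proof.
move=> g01; have s0 := ltW sigma_gt0; have s1 := ltW sigma_lt1.
have [|c] := @IVT R f sigma 1 g s1 (continuous_sub _ _ s0 (lexx _)).
  by rewrite (flux1 hf) min_r ?max_l// flux_ge0// s0.
rewrite in_itv /= => /andP[sc c1] <-.
by exists (Itv01 (le_trans s0 sc) c1).
Qed.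

(** * Entropy *)

Definition entropic a b := forall k : {i01 R},
  0 <= Num.sg (a%:num - k%:num) * (f a%:num - f k%:num)
     - Num.sg (b%:num - k%:num) * (f b%:num - f k%:num).

(** For b < a with the same flux, sigma is strictly between b and a, and the
    inequality at k = sigma reads 2 (f a - f sigma) >= 0. For a < b, the two
    signs differ only for k in [a, b], where f k >= f a because f is monotone on
    both sides of sigma. *)
Lemma entropyP a b :
  f a%:num = f b%:num -> entropic a b <-> a%:num <= b%:num.
Proof.
move=> fab; split=> [E|].
  rewrite leNgt; apply/negP => ba.
  have sa : sigma < a%:num.
    rewrite ltNge; apply/negP => as_.
    by have := flux_increasing _ _ (i01_ge0 b) ba as_; rewrite fab ltxx.
  have bs : b%:num < sigma.
    rewrite ltNge; apply/negP => sb.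
    by have := flux_decreasing _ _ sb ba (i01_le1 a); rewrite fab ltxx.
  have := E (Itv01 (ltW sigma_gt0) (ltW sigma_lt1)) => /=.
  rewrite gtr0_sg ?subr_gt0// ltr0_sg ?subr_lt0// fab mul1r mulN1r opprK.
  rewrite -mulr2n pmulrn_lge0// subr_ge0 leNgt => /negP; apply.
  exact: flux_increasing (i01_ge0 b) bs (lexx _).
rewrite le_eqVlt => /predU1P[/val_inj -> k|ab k]; first by rewrite subrr.
rewrite fab -mulrBl.
have [ka|ak] := ltP k%:num a%:num.
  have kb := lt_trans ka ab.
  by rewrite !gtr0_sg ?subr_gt0// subrr mul0r.
have [kb|bk] := leP k%:num b%:num; last first.
  have ak' := lt_trans ab bk.
  by rewrite !ltr0_sg ?subr_lt0// subrr mul0r.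
apply: mulr_le0.
  by rewrite subr_le0 (@le_trans _ _ 0)// ?sgr_le0 ?subr_le0// sgr_ge0 subr_ge0.
rewrite subr_le0; have [ks|sk] := leP k%:num sigma.
  move: ak; rewrite le_eqVlt => /predU1P[<-|ak]; first by rewrite fab.
  by rewrite -fab ltW// flux_increasing ?i01_ge0.
move: kb; rewrite le_eqVlt => /predU1P[->//|kb].
by rewrite ltW// flux_decreasing ?i01_le1// ltW.
Qed.

Lemma le_traces a b : f a%:num = f b%:num ->
  a%:num <= sigma \/ sigma <= b%:num -> a%:num <= b%:num.
Proof.
move=> fab side; rewrite leNgt; apply/negP => ba.
case: side => [as_|sb].
  by have := flux_increasing _ _ (i01_ge0 b) ba as_; rewrite fab ltxx.
by have := flux_decreasing _ _ sb ba (i01_le1 a); rewrite fab ltxx.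
Qed.

(** * Demand, supply and traces *)

Definition demand r := if r%:num <= sigma then f r%:num else f sigma.
Definition supply r := if r%:num <= sigma then f sigma else f r%:num.
Definition node_flux d := Num.min (demand d.1) (supply d.2).

Lemma Omega1E r : Omega1 f sigma r = `[0, demand r]%classic.
Proof. by rewrite /Omega1 /demand; case: ifP. Qed.

Lemma Omega2E r : Omega2 f sigma r = `[0, supply r]%classic.
Proof. by rewrite /Omega2 /supply; case: ifP. Qed.

Let peak_ge0 : 0 <= f sigma.
Proof. by apply: flux_ge0; rewrite !ltW. Qed.

Lemma demand_ge0 r : 0 <= demand r.
Proof. by rewrite /demand; case: ifP => // _; exact: flux_ge0. Qed.

Lemma supply_ge0 r : 0 <= supply r.
Proof. by rewrite /supply; case: ifP => // _; exact: flux_ge0. Qed.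

Lemma node_flux_bounds d : 0 <= node_flux d <= f sigma.
Proof.
rewrite le_min demand_ge0 supply_ge0 ge_min /demand.
by case: ifP => _; rewrite ?lexx// flux_le_peak.
Qed.

Lemma flux_le_demand r : f r%:num <= demand r.
Proof. by rewrite /demand; case: ifP => // _; exact: flux_le_peak. Qed.

Lemma flux_le_supply r : f r%:num <= supply r.
Proof. by rewrite /supply; case: ifP => // _; exact: flux_le_peak. Qed.

Lemma demand_right r : sigma <= r%:num -> demand r = f sigma.
Proof.
by rewrite /demand; case: ifP => // rs sr; congr f; apply/le_anti/andP.
Qed.

Lemma supply_right r : sigma <= r%:num -> supply r = f r%:num.
Proof.
by rewrite /supply; case: ifP => // rs sr; congr f; apply/le_anti/andP.
Qed.

Lemma incoming_state_ex r0 g :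
  0 <= g <= f sigma -> exists r, incoming_state f sigma r0 g r.
Proof.
move=> g01; rewrite /incoming_state; case: (_ == g); first by exists r0.
exact: flux_right_surj.
Qed.

Lemma outgoing_state_ex r0 g :
  0 <= g <= f sigma -> exists r, outgoing_state f sigma r0 g r.
Proof.
move=> g01; rewrite /outgoing_state; case: (_ == g); first by exists r0.
exact: flux_left_surj.
Qed.

Lemma incoming_state_flux r0 g r :
  incoming_state f sigma r0 g r -> f r%:num = g.
Proof. by rewrite /incoming_state; case: eqP => [<- ->|_ []]. Qed.

Lemma outgoing_state_flux r0 g r :
  outgoing_state f sigma r0 g r -> f r%:num = g.
Proof. by rewrite /outgoing_state; case: eqP => [<- ->|_ []]. Qed.

Lemma incoming_state_uniq r0 g a b :
  incoming_state f sigma r0 g a -> incoming_state f sigma r0 g b -> a = b.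
Proof.
rewrite /incoming_state; case: ifP => _; first by move=> -> ->.
by move=> [fa sa] [fb sb]; apply: flux_right_inj; rewrite // fa fb.
Qed.

Lemma outgoing_state_uniq r0 g a b :
  outgoing_state f sigma r0 g a -> outgoing_state f sigma r0 g b -> a = b.
Proof.
rewrite /outgoing_state; case: ifP => _; first by move=> -> ->.
by move=> [fa sa] [fb sb]; apply: flux_left_inj; rewrite // fa fb.
Qed.

(** The next four lemmas tell on which side of sigma the traces are: call a
    trace free in [0, sigma] and congested in [sigma, 1]. An incoming arc that
    sends its full demand has a free trace; one that is held back below its
    demand is congested. For the outgoing arc the sides are exchanged. *)
Lemma incoming_state_demand r0 r :
  incoming_state f sigma r0 (demand r0) r -> r%:num <= sigma.
Proof.
rewrite /incoming_state /demand; case: (leP r0%:num sigma) => [r0s|_].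
  by rewrite eqxx => ->.
case: ifP => [/eqP/flux_eq_peak <- -> //|_ [/flux_eq_peak -> _]].
exact: lexx.
Qed.

Lemma outgoing_state_supply r0 r :
  outgoing_state f sigma r0 (supply r0) r -> sigma <= r%:num.
Proof.
rewrite /outgoing_state /supply; case: (leP r0%:num sigma) => [_|r0s].
  by case: ifP => [/eqP/flux_eq_peak <- -> //|_ [/flux_eq_peak -> _]].
by rewrite eqxx => ->; exact: ltW.
Qed.

Lemma incoming_state_lt_demand r0 r :
  incoming_state f sigma r0 (f r%:num) r -> f r%:num < demand r0 ->
  sigma < r%:num.
Proof.
rewrite /incoming_state => st lt_fr.
have : sigma <= r%:num.
  case: eqP st => [_ rr0|_ []//].
  rewrite leNgt; apply/negP => rs.
  by move: lt_fr; rewrite -rr0 /demand ltW// ltxx.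
rewrite le_eqVlt => /predU1P[sr|//]; move: lt_fr; rewrite -sr ltNge => /negP[].
by rewrite /demand; case: ifP => // _; exact: flux_le_peak.
Qed.

Lemma outgoing_state_lt_supply r0 r :
  outgoing_state f sigma r0 (f r%:num) r -> f r%:num < supply r0 ->
  r%:num < sigma.
Proof.
rewrite /outgoing_state => st lt_fr.
have : r%:num <= sigma.
  case: eqP st => [_ rr0|_ []//].
  rewrite leNgt; apply/negP => sr.
  by move: lt_fr; rewrite -rr0 supply_right ?ltxx// ltW.
rewrite le_eqVlt => /predU1P[sr|//]; move: lt_fr; rewrite sr ltNge => /negP[].
by rewrite /supply; case: ifP => // _; exact: flux_le_peak.
Qed.

Definition node_traces d t :=
  incoming_state f sigma d.1 (node_flux d) t.1 /\
  outgoing_state f sigma d.2 (node_flux d) t.2.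

Lemma node_traces_uniq d t t' : node_traces d t -> node_traces d t' -> t = t'.
Proof.
case: t t' => [a b] [a' b'] [/= a1 b1] [/= a2 b2].
congr pair; first exact: incoming_state_uniq a1 a2.
exact: outgoing_state_uniq b1 b2.
Qed.

Lemma node_traces_flux d t : node_traces d t -> f t.1%:num = f t.2%:num.
Proof.
by move=> [/incoming_state_flux -> /outgoing_state_flux ->].
Qed.

(** The minimum defining the node flux is attained either by the demand, and
    then a <= sigma, or by the supply, and then sigma <= b. *)
Lemma node_traces_le d t : node_traces d t -> t.1%:num <= t.2%:num.
Proof.
move=> dt; apply: le_traces (node_traces_flux _ _ dt) _.
case: dt; rewrite /node_flux.
case: (leP (demand d.1)) => _ st1 st2; [left|right].
  exact: incoming_state_demand st1.
exact: outgoing_state_supply st2.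
Qed.

(** Consistency: if a <= b have the common flux g, then either a <= sigma and
    the demand of a is g, or b > sigma and the supply of b is g, so that g is
    the node flux of (a, b) and both traces are kept. *)
Lemma node_traces_id t :
  f t.1%:num = f t.2%:num -> t.1%:num <= t.2%:num -> node_traces t t.
Proof.
move=> ft le_t; suff gE : node_flux t = f t.1%:num.
  by split; rewrite /incoming_state /outgoing_state gE ft eqxx.
apply/le_anti; rewrite le_min flux_le_demand ft flux_le_supply andbT /node_flux.
rewrite ge_min -{1}ft; have [t1s|st1] := leP t.1%:num sigma.
  by rewrite {1}/demand t1s lexx.
by rewrite supply_right ?lexx ?orbT// (le_trans (ltW st1)).
Qed.

(** Where entropy forces the maximal flux: if both arcs were held back, the
    incoming trace would be congested and the outgoing one free, that is
    b < sigma < a, against a <= b. *)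
Lemma entropic_node_traces d t :
  f t.1%:num = f t.2%:num -> t.1%:num <= t.2%:num ->
  f t.1%:num <= demand d.1 -> incoming_state f sigma d.1 (f t.1%:num) t.1 ->
  f t.2%:num <= supply d.2 -> outgoing_state f sigma d.2 (f t.2%:num) t.2 ->
  node_traces d t.
Proof.
move=> ft le_t le_dem st1 le_sup st2; suff gE : node_flux d = f t.1%:num.
  by split; rewrite gE// ft.
apply/le_anti; rewrite /node_flux le_min le_dem ft le_sup !andbT leNgt lt_min.
apply/negP => /andP[lt_dem lt_sup]; rewrite -ft in lt_dem.
have := lt_trans (outgoing_state_lt_supply _ _ st2 lt_sup)
                 (incoming_state_lt_demand _ _ st1 lt_dem).
by rewrite ltNge le_t.
Qed.

(** * Wave conditions *)

Section Waves.
Variable tau : {i01 R} -> {i01 R}.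
Hypothesis htau : is_tau f sigma tau.

Let tau_flux r : f (tau r)%:num = f r%:num.
Proof. exact: htau.1. Qed.

Lemma tau_left r : r%:num <= sigma -> sigma <= (tau r)%:num.
Proof.
rewrite le_eqVlt => /predU1P[rs|rs].
  by rewrite (flux_eq_peak (tau r)) ?tau_flux ?rs.
rewrite leNgt; apply/negP => ts; apply: (htau.2 r).
  by apply/eqP; rewrite lt_eqF.
by apply: flux_left_inj; rewrite ?ltW ?tau_flux.
Qed.

Lemma tau_right r : sigma <= r%:num -> (tau r)%:num <= sigma.
Proof.
rewrite le_eqVlt => /predU1P[sr|sr].
  by rewrite (flux_eq_peak (tau r)) ?tau_flux -?sr.
rewrite leNgt; apply/negP => st; apply: (htau.2 r).
  by apply/eqP; rewrite gt_eqF.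
by apply: flux_right_inj; rewrite ?ltW ?tau_flux.
Qed.

(** On the congested side, lying beyond tau r0 means having a flux below
    f (tau r0) = f r0, which is the demand of a free datum. *)
Lemma negative_wavesP r0 r : negative_waves sigma tau r0 r <->
  f r%:num <= demand r0 /\ incoming_state f sigma r0 (f r%:num) r.
Proof.
rewrite /negative_waves /incoming_state /= !in_itv /= !i01_le1 !andbT; split.
- move=> [neg_left neg_right]; have [r0s|sr0] := leP r0%:num sigma.
    case: (neg_left r0s) => [/val_inj ->|lt_tau].
      by rewrite flux_le_demand eqxx.
    have st := tau_left _ r0s; have sr := le_trans st (ltW lt_tau).
    have lt_fr : f r%:num < f r0%:num by rewrite -(tau_flux r0) flux_right_lt.
    by rewrite /demand r0s (ltW lt_fr) gt_eqF.
  have sr := neg_right (ltW sr0).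
  rewrite (demand_right _ (ltW sr0)); split; first exact: flux_le_peak.
  by case: eqP => // fr; apply: flux_right_inj; rewrite // ltW.
- move=> [le_dem st]; split=> [r0s|sr0]; last first.
    by case: eqP st => [_ -> //|_ []].
  move: le_dem; rewrite /demand r0s.
  case: eqP st => [_ -> _|fr [_ sr] le_fr]; [by left|right].
  rewrite -flux_right_lt ?tau_left// tau_flux lt_neqAle le_fr andbT.
  by rewrite eq_sym; exact/eqP.
Qed.

Lemma positive_wavesP r0 r : positive_waves sigma tau r0 r <->
  f r%:num <= supply r0 /\ outgoing_state f sigma r0 (f r%:num) r.
Proof.
rewrite /positive_waves /outgoing_state /= !in_itv /= !i01_ge0 /=; split.
- move=> [pos_left pos_right]; have [sr0|r0s] := leP sigma r0%:num.
    case: (pos_right sr0) => [/val_inj ->|lt_tau].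
      by rewrite flux_le_supply eqxx.
    have ts := tau_right _ sr0; have rs := le_trans (ltW lt_tau) ts.
    have lt_fr : f r%:num < f r0%:num by rewrite -(tau_flux r0) flux_left_lt.
    by rewrite supply_right// (ltW lt_fr) gt_eqF.
  have rs := pos_left (ltW r0s).
  rewrite /supply (ltW r0s); split; first exact: flux_le_peak.
  by case: eqP => // fr; apply: flux_left_inj; rewrite // ltW.
- move=> [le_sup st]; split=> [r0s|sr0].
    by case: eqP st => [_ -> //|_ []].
  move: le_sup; rewrite supply_right//.
  case: eqP st => [_ -> _|fr [_ rs] le_fr]; [by left|right].
  rewrite -flux_left_lt ?tau_right// tau_flux lt_neqAle le_fr andbT.
  by rewrite eq_sym; exact/eqP.
Qed.

Lemma entropic_solverP (S : data -> data) :
  (riemann_solver f sigma tau S /\ E1 f S) <-> forall d, node_traces d (S d).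
Proof.
split=> [[solS entS] d|trS].
  have [fS /negative_wavesP[? ?] /positive_wavesP[? ?]] := solS d.
  apply: entropic_node_traces => //.
  by apply/entropyP => // k; exact: entS.
split=> d; have fS := node_traces_flux _ _ (trS d).
  have [st1 st2] := trS d; split=> //.
    apply/negative_wavesP; rewrite (incoming_state_flux _ _ _ st1).
    by rewrite {1}/node_flux ge_min lexx.
  apply/positive_wavesP; rewrite (outgoing_state_flux _ _ _ st2).
  by rewrite {1}/node_flux ge_min lexx orbT.
by apply/entropyP; rewrite // (node_traces_le _ _ (trS d)).
Qed.

End Waves.

(** * The solvers for car traffic and for data networks *)

Lemma RS1P d t : RS1 f sigma d t <-> node_traces d t.
Proof.
have inI g : (Omega1 f sigma d.1 g /\ Omega2 f sigma d.2 g) <->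
    0 <= g <= node_flux d.
  rewrite Omega1E Omega2E /= !in_itv /= le_min.
  by split=> [[/andP[-> ->] /andP[_ ->]]|/and3P[-> -> ->]].
have /andP[g0 _] := node_flux_bounds d.
have max_flux : is_maximizer
    [set g | Omega1 f sigma d.1 g /\ Omega2 f sigma d.2 g]%classic
    (node_flux d).
  by split=> /= [|g /inI/andP[]//]; apply/inI; rewrite g0 lexx.
split=> [[g1 [_ [[/= /inI/andP[_ le_g1] ub_g1] -> st1 st2]]]|[st1 st2]].
  suff g1E : g1 = node_flux d by rewrite g1E in st1 st2.
  by apply/le_anti; rewrite le_g1 ub_g1//; exact: max_flux.1.
by exists (node_flux d), (node_flux d).
Qed.

Lemma RS2P d t : RS2 f sigma d t <-> node_traces d t.
Proof.
rewrite /RS2 Omega1E Omega2E !sup_itvcc ?demand_ge0 ?supply_ge0//.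
rewrite -/(node_flux d).
split=> [[g1 [g2 [[[_ ->] _] [[_ ->] _] st1 st2]]] //|[st1 st2]].
have /andP[g0 _] := node_flux_bounds d.
exists (node_flux d), (node_flux d).
split=> //; split=> [|q [_ ->]//]; split=> //=.
  by rewrite in_itv /= g0 ge_min lexx.
by rewrite in_itv /= g0 ge_min lexx orbT.
Qed.

Lemma node_solver_ex : exists S : data -> data, forall d, node_traces d (S d).
Proof.
suff /choice[S] : forall d, exists t, node_traces d t by exists S.
move=> d; have gb := node_flux_bounds d.
have [a st1] := incoming_state_ex d.1 _ gb.
by have [b st2] := outgoing_state_ex d.2 _ gb; exists (a, b).
Qed.

End Node.

Theorem theorem4p1 (R : realType) (f : R -> R) (sigma : R)
    (tau : {i01 R} -> {i01 R})
    (hf : is_flux f sigma) (htau : is_tau f sigma tau) :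
  exists RS : {i01 R} * {i01 R} -> {i01 R} * {i01 R},
    [/\ unique (fun S => riemann_solver f sigma tau S /\ E1 f S) RS,
        consistent RS,
        coincides RS (RS1 f sigma) &
        coincides RS (RS2 f sigma)].
Proof.
have [RS trRS] := node_solver_ex hf.
have tracesE d t : node_traces (f := f) (sigma := sigma) d t <-> t = RS d.
  by split=> [dt|-> //]; exact: (node_traces_uniq hf d).
exists RS; split.
- split=> [|S /(entropic_solverP hf tau htau) trS].
    exact/(entropic_solverP hf tau htau).
  by apply/funext => d; apply/esym/tracesE.
- move=> d; apply/esym/tracesE/(node_traces_id hf).
    exact: (node_traces_flux _ _ (trRS d)).
  exact: (node_traces_le hf _ _ (trRS d)).
- by move=> d t; rewrite (RS1P hf).
- by move=> d t; rewrite (RS2P hf).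
Qed.
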